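(* Let $m\ge1$ and $n\ge0$. There is an isomorphism of symmetric quadratic groups $$(\mathcal T_{2n})^c_e\cong\mathcal T^\infty_{2n}$$ which is the identity on $\mathcal T_{2n}$ and takes $q(J)$ to $J^\infty$ for rooted trees $J$ of order $n$. The quadratic group structure on $\mathcal T^\infty_{2n}$ is given by the homomorphisms $\mathcal T_{2n}\xrightarrow{p}\mathcal T^\infty_{2n}\xrightarrow{h}\mathcal T_{2n}$ which are uniquely characterized (for unrooted trees $t$ and rooted trees $J$) by $$p(t)=t,\qquad h(t)=2\cdot t,\qquad h(J^\infty)=\langle J,J\rangle.$$
   Context: **Trees.** Fix $m\ge1$. Trees are finite unitrivalent trees with a cyclic ordering of the edges at each trivalent vertex; the order is the number of trivalent vertices. Univalent vertices are labeled by $\{1,\dots,m\}$, except that a rooted tree has one distinguished unlabeled univalent vertex (the root). For rooted trees $I,J$, the rooted product $(I,J)$ is obtained by identifying the two roots to a vertex and adjoining a rooted edge there (cyclic order given by the ordering of $I,J$); $\langle I,J\rangle$ is the unrooted tree obtained by gluing the two root edges into a single edge. $-J$ denotes $J$ with one cyclic ordering reversed. AS relation: reversing one cyclic ordering changes the sign. IHX relation: $I-H+X=0$ for three trees which agree except that a rooted subtree $(A,(B,C))$ of $I$ is replaced by $((A,B),C)$ in $H$ and by $((A,C),B)$ in $X$. $\mathcal T_n$ is the abelian group generated by order $n$ unrooted trees modulo AS and IHX. $\mathcal T^\infty_{2n}$ is generated by $\mathcal T_{2n}$ and symbols $J^\infty$ for order $n$ rooted trees $J$, with the additional relations $J^\infty=(-J)^\infty$,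 $2J^\infty=\langle J,J\rangle$, and $I^\infty=H^\infty+X^\infty-\langle H,X\rangle$ whenever $I,H,X$ are rooted trees as in an IHX relation $I=H-X$. $\mathsf L'_{n+1}$ is the degree $n+1$ part of the free quasi-Lie algebra over $\mathbb Z$ on $m$ generators (Lie algebra axioms with $[X,X]=0$ weakened to $[X,Y]=-[Y,X]$); equivalently, the abelian group generated by order $n$ rooted trees modulo AS and IHX. Gluing roots induces a symmetric bilinear form $\langle\cdot,\cdot\rangle:\mathsf L'_{n+1}\times\mathsf L'_{n+1}\to\mathcal T_{2n}$. **Symmetric quadratic groups.** A symmetric quadratic group $(M_e\xrightarrow{h}M_{ee}\xrightarrow{p}M_e)$ consists of abelian groups $M_e,M_{ee}$ and homomorphisms $h,p$ with $hp=2\,\mathrm{id}$ and $ph=2\,\mathrm{id}$; morphisms are pairs of homomorphisms commuting with $h,p$. **The universal one.** For a symmetric bilinear form $\lambda:A\times A\to M_{ee}$ (trivial involution on $M_{ee}$), let $M_{ee}\times_\lambda A$ be the set of pairs with addition $(m,a)+(m',a')=(m+m'-\lambda(a,a'),a+a')$, and let $M_e^c$ be its quotient by the relations $(-2\lambda(a,a),-2a)=0$, $a\in A$. With $p(m)=[m,0]$ and $h[m,a]=2m+\lambda(a,a)$ this is a symmetric quadratic group, and $\mu^c_\lambda(a)=[0,a]$ is the universal symmetric quadratic refinement of $\lambda$. For $\lambda=\langle\cdot,\cdot\rangle$, $A=\mathsf L'_{n+1}$, $M_{ee}=\mathcal T_{2n}$, write $(\mathcal T_{2n})^c_e:=M^c_e$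 and $q:=\mu^c_{\langle\cdot,\cdot\rangle}:\mathsf L'_{n+1}\to(\mathcal T_{2n})^c_e$. *)

(* Defs.v *)
From HB Require Import structures.
From mathcomp Require Import all_boot all_order all_algebra.
From mathcomp Require Import boolp.
From mathcomp Require Import freeg.

Set Implicit Arguments.
Unset Strict Implicit.
Unset Printing Implicit Defensive.

Import GRing.Theory.
Local Open Scope ring_scope.

(* A finite graph is encoded by its darts (half-edges).  The edges are the
   pairs [{d, flip d}]; the vertices are the orbits of [nxt], which sends a
   dart to the next one in the cyclic ordering at its vertex.  [label] gives
   the label of the univalent vertex consisting of the dart, if any; ['I_m]
   stands for the label set {1, ..., m}. *)
Record ugraph (m : nat) (D : finType) := UGraph {
  flip : D -> D;
  nxt : D -> D;
  label : D -> option 'I_m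
}.

(* One move along an edge or around a vertex.  [nxt] and [flip] are
   permutations of a finite type in the graphs below, so reachability along
   [step] (resp. [step_off G c], where the edge of [c] has been deleted) is
   symmetric. *)
Definition step m (D : finType) (G : ugraph m D) : rel D :=
  fun d e => (e == flip G d) || (e == nxt G d).

Definition step_off m (D : finType) (G : ugraph m D) (c : D) : rel D :=
  fun d e => [&& e == flip G d, d != c & d != flip G c] || (e == nxt G d).

(* [nxt3] says that every vertex has valence 1 or 3; [tree_acyclic] says that
   every edge is a bridge. *)
Record is_tree m (D : finType) (G : ugraph m D) : Prop := IsTree {
  flipK : involutive (flip G);
  flip_neq : forall d, flip G d != d;
  nxt3 : forall d, nxt G (nxt G (nxt G d)) = d;
  tree_nonempty : (0 < #|D|)%N;
  tree_connected : forall d e, connect (step G) d e;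
  tree_acyclic : forall d, ~~ connect (step_off G d) d (flip G d)
}.

(* The darts sitting at a trivalent vertex. *)
Definition trivalent m (D : finType) (G : ugraph m D) : pred D :=
  [pred d | nxt G d != d].

(* The number of [nxt]-orbits of size 3. *)
Definition tree_order m (D : finType) (G : ugraph m D) : nat :=
  fcard (nxt G) (trivalent G).

(* In an unrooted tree the univalent vertices are exactly the labelled ones;
   in a rooted tree all of them but the root are labelled. *)
Definition is_unrooted m (D : finType) (G : ugraph m D) : Prop :=
  is_tree G /\ forall d, (label G d == None) = trivalent G d.

Definition is_rooted m (D : finType) (G : ugraph m D) (r : D) : Prop :=
  [/\ is_tree G, nxt G r = r
    & forall d, (label G d == None) = trivalent G d || (d == r)].

Definition giso m (D E : finType) (G : ugraph m D) (H : ugraph m E)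
    (f : D -> E) : Prop :=
  [/\ bijective f, {morph f : d / flip G d >-> flip H d},
      {morph f : d / nxt G d >-> nxt H d} & forall d, label H (f d) = label G d].

Definition iso m (D E : finType) (G : ugraph m D) (H : ugraph m E) : Prop :=
  exists f, giso G H f.

Definition riso m (D E : finType) (G : ugraph m D) (r : D)
    (H : ugraph m E) (s : E) : Prop :=
  exists2 f, giso G H f & f r = s.

(* [G] with the cyclic ordering reversed at the (trivalent) vertex of [v]:
   there [nxt] is replaced by its inverse, [nxt \o nxt]. *)
Definition rev_at m (D : finType) (G : ugraph m D) (v : D) : ugraph m D :=
  UGraph (flip G)
    (fun d => if d \in [:: v; nxt G v; nxt G (nxt G v)]
              then nxt G (nxt G d) else nxt G d)
    (label G).

(* The default value of [insubd] is irrelevant when [K] is stable under [flip]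
   and [nxt], see [glue_closed]. *)
Definition restrict m (D : finType) (G : ugraph m D) (K : pred D) :
    ugraph m {x : D | K x} :=
  UGraph (fun x => insubd x (flip G (val x))) (fun x => insubd x (nxt G (val x)))
    (fun x => label G (val x)).

(* Gluing the root edges of [(G, r)] and [(H, s)] into a single edge: the
   darts [r] and [s] are discarded and [flip G r], [flip H s] are matched. *)
Definition glue_all m (D E : finType) (G : ugraph m D) (r : D)
    (H : ugraph m E) (s : E) : ugraph m (D + E)%type :=
  UGraph
    (fun x => match x with
       | inl d => if flip G d == r then inr (flip H s) else inl (flip G d)
       | inr e => if flip H e == s then inl (flip G r) else inr (flip H e)
     end)
    (fun x => match x with inl d => inl (nxt G d) | inr e => inr (nxt H e) end)
    (fun x => match x with inl d => label G d | inr e => label H e end).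

Definition nonroot (D E : finType) (r : D) (s : E) : pred (D + E)%type :=
  fun x => match x with inl d => d != r | inr e => e != s end.

Definition glue_graph m (D E : finType) (G : ugraph m D) (r : D)
    (H : ugraph m E) (s : E) := restrict (glue_all G r H s) (nonroot r s).

(* The rooted product: [r] and [s] become darts of a new trivalent vertex whose
   third dart is [inr true]; [inr false] is the new root.  The cyclic ordering
   at the new vertex is (root edge, [G], [H]). *)
Definition prod_graph m (D E : finType) (G : ugraph m D) (r : D)
    (H : ugraph m E) (s : E) : ugraph m (D + E + bool)%type :=
  UGraph
    (fun x => match x with
       | inl (inl d) => inl (inl (flip G d))
       | inl (inr e) => inl (inr (flip H e))
       | inr b => inr (~~ b)
     end)
    (fun x => match x with
       | inl (inl d) => if d == r then inl (inr s) else inl (inl (nxt G d))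
       | inl (inr e) => if e == s then inr true else inl (inr (nxt H e))
       | inr true => inl (inl r)
       | inr false => inr false
     end)
    (fun x => match x with
       | inl (inl d) => label G d
       | inl (inr e) => label H e
       | inr _ => None
     end).

(* Transport to an ordinal type, so that the trees form a small type. *)
Definition std m (D : finType) (G : ugraph m D) : ugraph m 'I_#|D| :=
  UGraph (fun i => enum_rank (flip G (enum_val i)))
    (fun i => enum_rank (nxt G (enum_val i))) (fun i => label G (enum_val i)).

Lemma connect_inv (T : finType) (r : rel T) (P : T -> Prop) x y :
  (forall a b, r a b -> P a -> P b) -> connect r x y -> P x -> P y.
Proof.
move=> rP /connectP[p]; elim: p x => [|z p IH] x /=; first by move=> _ ->.
by case/andP=> xz zp yE Px; apply: (IH z zp yE); apply: rP xz Px.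
Qed.

Lemma connect_hom (T U : finType) (r : rel T) (s : rel U) (f : T -> U) x y :
  (forall a b, r a b -> connect s (f a) (f b)) ->
  connect r x y -> connect s (f x) (f y).
Proof.
move=> rs rxy; apply: (connect_inv (P := fun z => connect s (f x) (f z))) rxy _.
  by move=> a b rab xa; apply: connect_trans xa (rs _ _ rab).
exact: connect0.
Qed.

Lemma nxt_inj m (D : finType) (G : ugraph m D) : is_tree G -> injective (nxt G).
Proof. by move=> tG x y xy; rewrite -(nxt3 tG x) xy nxt3. Qed.

Lemma flip_inj m (D : finType) (G : ugraph m D) : is_tree G -> injective (flip G).
Proof. by move=> tG; apply: inv_inj (flipK tG). Qed.

Lemma step_flip m (D : finType) (G : ugraph m D) d : step G d (flip G d).
Proof. by rewrite /step eqxx. Qed.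

Lemma step_nxt m (D : finType) (G : ugraph m D) d : step G d (nxt G d).
Proof. by rewrite /step eqxx orbT. Qed.

Lemma nxt_root_neq m (D : finType) (G : ugraph m D) r d :
  is_tree G -> nxt G r = r -> d != r -> nxt G d != r.
Proof. by move=> tG rr; apply: contra => /eqP dr; apply/eqP/(nxt_inj tG); rewrite dr. Qed.

Lemma tree_order3 m (D : finType) (G : ugraph m D) :
  (forall d, nxt G (nxt G (nxt G d)) = d) ->
  (tree_order G * 3 = #|trivalent G|)%N.
Proof.
move=> n3; have ninj : injective (nxt G) by move=> x y xy; rewrite -(n3 x) xy n3.
apply: fcard_order_set => //.
  apply/subsetP=> d; rewrite !inE => dn.
  have d2 : nxt G (nxt G d) != d.
    by apply: contra dn => /eqP h; rewrite -{1}h n3.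
  apply/eqP; apply: (order_cycle (p := [:: d; nxt G d; nxt G (nxt G d)])).
  - by rewrite /= !eqxx n3 eqxx.
  - by rewrite /= !inE negb_or eq_sym dn eq_sym d2 (inj_eq ninj) eq_sym dn.
  - by rewrite inE eqxx.
by move=> x y /eqP <-; rewrite !inE (inj_eq ninj).
Qed.

Lemma giso_refl m (D : finType) (G : ugraph m D) : giso G G id.
Proof. by split=> //; exists id. Qed.

Lemma giso_sym m (D E : finType) (G : ugraph m D) (H : ugraph m E) f :
  giso G H f -> exists2 g, giso H G g & cancel f g.
Proof.
case=> -[g fK gK] fo fn fl; exists g => //; split; first by exists f.
- by move=> e; apply: (can_inj fK); rewrite gK fo gK.
- by move=> e; apply: (can_inj fK); rewrite gK fn gK.
- by move=> e; rewrite -fl gK.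
Qed.

Lemma giso_comp m (D E F : finType) (G : ugraph m D) (H : ugraph m E)
    (K : ugraph m F) f g : giso G H f -> giso H K g -> giso G K (g \o f).
Proof.
move=> [bf fo fn fl] [bg go gn gl]; split; first exact: bij_comp.
- by move=> d /=; rewrite fo go.
- by move=> d /=; rewrite fn gn.
- by move=> d /=; rewrite gl fl.
Qed.

Lemma iso_refl m (D : finType) (G : ugraph m D) : iso G G.
Proof. by exists id; apply: giso_refl. Qed.

Lemma iso_sym m (D E : finType) (G : ugraph m D) (H : ugraph m E) :
  iso G H -> iso H G.
Proof. by case=> f /giso_sym[g hg _]; exists g. Qed.

Lemma iso_trans m (D E F : finType) (G : ugraph m D) (H : ugraph m E)
    (K : ugraph m F) : iso G H -> iso H K -> iso G K.
Proof. by move=> [f hf] [g hg]; exists (g \o f); apply: giso_comp hf hg. Qed.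

Lemma giso_std m (D : finType) (G : ugraph m D) : giso G (std G) enum_rank.
Proof.
split; first exact: enum_rank_bij.
- by move=> d /=; rewrite enum_rankK.
- by move=> d /=; rewrite enum_rankK.
- by move=> d /=; rewrite enum_rankK.
Qed.

Lemma giso_tree m (D E : finType) (G : ugraph m D) (H : ugraph m E) f :
  giso G H f -> is_tree G -> is_tree H.
Proof.
move=> fi tG; have [[g fK gK] fo fn fl] := fi.
have [g' [bg go gn gl] gg'] := giso_sym fi.
have {gg'} e_gg x : g' x = g x by rewrite -[x]gK gg' fK.
have {}go : {morph g : d / flip H d >-> flip G d} by move=> x; rewrite -!e_gg.
have {}gn : {morph g : d / nxt H d >-> nxt G d} by move=> x; rewrite -!e_gg.
split.
- by move=> e; apply: (can_inj gK); rewrite !go (flipK tG).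
- by move=> e; rewrite -(inj_eq (can_inj gK)) go (flip_neq tG).
- by move=> e; apply: (can_inj gK); rewrite !gn (nxt3 tG).
- by have := tree_nonempty tG; rewrite (bij_eq_card (Bijective fK gK)).
- move=> d e; rewrite -[d]gK -[e]gK; apply: connect_hom (tree_connected tG _ _).
  by move=> a b /orP[] /eqP->; apply: connect1; rewrite ?fo ?fn ?step_flip ?step_nxt.
- move=> e; apply: contra (tree_acyclic tG (g e)); rewrite -go.
  apply: connect_hom => a b; rewrite /step_off => ab; apply: connect1.
  case/orP: ab => [/and3P[/eqP-> ac aoc]|/eqP->]; last by rewrite gn eqxx orbT.
  by rewrite -!go !(inj_eq (can_inj gK)) eqxx ac aoc.
Qed.

Lemma giso_trivalent m (D E : finType) (G : ugraph m D) (H : ugraph m E) f d :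
  giso G H f -> trivalent H (f d) = trivalent G d.
Proof. by case=> bf _ fn _; rewrite /trivalent /= -fn (inj_eq (bij_inj bf)). Qed.

Lemma giso_order m (D E : finType) (G : ugraph m D) (H : ugraph m E) f :
  giso G H f -> is_tree G -> tree_order H = tree_order G.
Proof.
move=> fi tG; apply/eqP; rewrite -(eqn_pmul2r (isT : 0 < 3)%N) !tree_order3; last first.
- exact: nxt3 (giso_tree fi tG).
- exact: nxt3 tG.
have [bf _ _ _] := fi; have [g fK gK] := bf.
rewrite -(card_image (bij_inj bf) (trivalent G)); apply/eqP/eq_card => e.
rewrite -[e]gK (mem_image (bij_inj bf)) -!topredE.
exact: giso_trivalent fi.
Qed.

Lemma unrooted_iso m (D E : finType) (G : ugraph m D) (H : ugraph m E) f :
  giso G H f -> is_unrooted G -> is_unrooted H.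
Proof.
move=> fi [tG lG]; split; first exact: giso_tree fi tG.
have [[g fK gK] _ _ fl] := fi.
by move=> e; rewrite -[e]gK fl (giso_trivalent _ fi).
Qed.

Lemma rooted_iso m (D E : finType) (G : ugraph m D) r (H : ugraph m E) f :
  giso G H f -> is_rooted G r -> is_rooted H (f r).
Proof.
move=> fi [tG rr lG]; have [[g fK gK] _ fn fl] := fi.
split; [exact: giso_tree fi tG | by rewrite -fn rr |].
by move=> e; rewrite -[e]gK fl (giso_trivalent _ fi) (inj_eq (can_inj fK)).
Qed.

Lemma val_insubd (T : eqType) (P : pred T) (sT : subType P) (u : sT) (x : T) :
  P x -> val (insubd u x) = x.
Proof. by move=> Px; rewrite insubdK. Qed.

Lemma restrict_iso m (D E : finType) (G : ugraph m D) (H : ugraph m E)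
    (K : pred D) (L : pred E) (f : D -> E) (g : E -> D) :
  {in K, forall x, K (flip G x) /\ K (nxt G x)} ->
  {in L, forall y, L (flip H y) /\ L (nxt H y)} ->
  {in K, forall x, L (f x)} -> {in L, forall y, K (g y)} ->
  {in K, cancel f g} -> {in L, cancel g f} ->
  {in K, {morph f : x / flip G x >-> flip H x}} ->
  {in K, {morph f : x / nxt G x >-> nxt H x}} ->
  {in K, forall x, label H (f x) = label G x} ->
  iso (restrict G K) (restrict H L).
Proof.
move=> KG LH fL gK fgK gfK fo fn fl.
pose f' (x : {x | K x}) : {y | L y} := exist _ (f (val x)) (fL _ (valP x)).
pose g' (y : {y | L y}) : {x | K x} := exist _ (g (val y)) (gK _ (valP y)).
exists f'; split.
- exists g' => x; apply: val_inj => /=; [apply: fgK | apply: gfK]; exact: valP.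
- move=> x; apply: val_inj; rewrite /= !val_insubd ?fo //; try exact: valP.
    by case: (LH _ (fL _ (valP x))).
  by case: (KG _ (valP x)).
- move=> x; apply: val_inj; rewrite /= !val_insubd ?fn //; try exact: valP.
    by case: (LH _ (fL _ (valP x))).
  by case: (KG _ (valP x)).
- by move=> x /=; apply: fl; apply: valP.
Qed.

Lemma glue_closed m (D E : finType) (G : ugraph m D) r (H : ugraph m E) s :
  is_rooted G r -> is_rooted H s ->
  {in nonroot r s, forall x,
    nonroot r s (flip (glue_all G r H s) x) /\
    nonroot r s (nxt (glue_all G r H s) x)}.
Proof.
move=> [tG rG _] [tH rH _] [d|e]; rewrite -topredE /= => h; split.
- by case: eqP => //=; rewrite ?(flip_neq tH) // => /eqP.
- exact: nxt_root_neq.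
- by case: eqP => //=; rewrite ?(flip_neq tG) // => /eqP.
- exact: nxt_root_neq.
Qed.

Section GlueTree.
Context (m : nat) (D E : finType) (G : ugraph m D) (r : D)
  (H : ugraph m E) (s : E) (rG : is_rooted G r) (rH : is_rooted H s).

Let tG : is_tree G. Proof. by case: rG. Qed.
Let tH : is_tree H. Proof. by case: rH. Qed.
Let nr : nxt G r = r. Proof. by case: rG. Qed.
Let ns : nxt H s = s. Proof. by case: rH. Qed.

Let GH := glue_graph G r H s.
Let raw := glue_all G r H s.

Lemma val_glue_flip x : val (flip GH x) = flip raw (val x).
Proof. by rewrite val_insubd //; case: (glue_closed rG rH (valP x)). Qed.

Lemma val_glue_nxt x : val (nxt GH x) = nxt raw (val x).
Proof. by rewrite val_insubd //; case: (glue_closed rG rH (valP x)). Qed.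

Let raw_flip x : nonroot r s x ->
  [/\ flip raw (flip raw x) = x, flip raw x != x
    & nxt raw (nxt raw (nxt raw x)) = x].
Proof.
case: x => [d|e] /= h; split; rewrite ?(nxt3 tG) ?(nxt3 tH) //.
- case: (eqVneq (flip G d) r) => [dr|dr] /=.
    by rewrite (flipK tH) eqxx -dr (flipK tG).
  by rewrite (flipK tG) (negPf h).
- by case: ifP => _ //; rewrite (inj_eq inl_inj) (flip_neq tG).
- case: (eqVneq (flip H e) s) => [es|es] /=.
    by rewrite (flipK tG) eqxx -es (flipK tH).
  by rewrite (flipK tH) (negPf h).
- by case: ifP => _ //; rewrite (inj_eq inr_inj) (flip_neq tH).
Qed.

Let embG_nr d : nonroot r s (inl (if d == r then flip G r else d)).
Proof. by rewrite /=; case: (eqVneq d r) => // _; rewrite (flip_neq tG). Qed.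
Let embH_nr e : nonroot r s (inr (if e == s then flip H s else e)).
Proof. by rewrite /=; case: (eqVneq e s) => // _; rewrite (flip_neq tH). Qed.
Let embG d : {x : D + E | nonroot r s x} := exist (nonroot r s) _ (embG_nr d).
Let embH e : {x : D + E | nonroot r s x} := exist (nonroot r s) _ (embH_nr e).

Let embG_step a b : step G a b -> connect (step GH) (embG a) (embG b).
Proof.
case/orP => /eqP->.
  case: (eqVneq a r) => [->|ar].
    apply/eq_connect0/val_inj; rewrite /= eqxx.
    by rewrite (negPf (flip_neq tG r)).
  case: (eqVneq (flip G a) r) => [ar'|ar'].
    apply/eq_connect0/val_inj; rewrite /= ar' eqxx (negPf ar).
    by rewrite -ar' (flipK tG).
  apply/connect1; rewrite /step; apply/orP; left; apply/eqP/val_inj.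
  by rewrite val_glue_flip /= (negPf ar) (negPf ar').
case: (eqVneq a r) => [->|ar]; first by rewrite nr connect0.
apply/connect1; rewrite /step; apply/orP; right; apply/eqP/val_inj.
by rewrite val_glue_nxt /= (negPf ar) (negPf (nxt_root_neq tG nr ar)).
Qed.

Let embH_step a b : step H a b -> connect (step GH) (embH a) (embH b).
Proof.
case/orP => /eqP->.
  case: (eqVneq a s) => [->|ar].
    apply/eq_connect0/val_inj; rewrite /= eqxx.
    by rewrite (negPf (flip_neq tH s)).
  case: (eqVneq (flip H a) s) => [ar'|ar'].
    apply/eq_connect0/val_inj; rewrite /= ar' eqxx (negPf ar).
    by rewrite -ar' (flipK tH).
  apply/connect1; rewrite /step; apply/orP; left; apply/eqP/val_inj.
  by rewrite val_glue_flip /= (negPf ar) (negPf ar').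
case: (eqVneq a s) => [->|ar]; first by rewrite ns connect0.
apply/connect1; rewrite /step; apply/orP; right; apply/eqP/val_inj.
by rewrite val_glue_nxt /= (negPf ar) (negPf (nxt_root_neq tH ns ar)).
Qed.

Let glue_bridge :
  connect (step GH) (embG r) (embH s) /\ connect (step GH) (embH s) (embG r).
Proof.
split; apply/connect1; rewrite /step; apply/orP; left; apply/eqP/val_inj;
  by rewrite val_glue_flip /= !eqxx ?(flipK tG) ?(flipK tH) eqxx.
Qed.

Let emb_cover x : (exists d, x = embG d) \/ (exists e, x = embH e).
Proof.
case: x => -[d|e] h; [left; exists d | right; exists e]; apply: val_inj;
  by rewrite /= (negPf h).
Qed.

Lemma glue_tree : is_tree GH.
Proof.
split.
- move=> x; apply: val_inj; rewrite !val_glue_flip.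
  by case: (raw_flip (valP x)).
- move=> x; apply/eqP => /(congr1 val); rewrite val_glue_flip => /eqP.
  by apply/negP; case: (raw_flip (valP x)).
- move=> x; apply: val_inj; rewrite !val_glue_nxt.
  by case: (raw_flip (valP x)).
- by apply/card_gt0P; exists (embG r).
- have [GH1 HG1] := glue_bridge.
  have GG a b : connect (step GH) (embG a) (embG b).
    exact: connect_hom embG_step (tree_connected tG a b).
  have HH a b : connect (step GH) (embH a) (embH b).
    exact: connect_hom embH_step (tree_connected tH a b).
  move=> x y; case: (emb_cover x) => -[a ->]; case: (emb_cover y) => -[b ->].
  + exact: GG.
  + exact: connect_trans (GG a r) (connect_trans GH1 (HH s b)).
  + exact: connect_trans (HH a s) (connect_trans HG1 (GG r b)).
  + exact: HH.
- move=> x; apply/negP => cx; have xK := valP x.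
  case x_eq: (val x) xK => [d|e] /= xK.
  + pose S (z : D + E) := match z with
      | inl a => connect (step_off G d) d a
      | inr b => connect (step_off G d) d (flip G r) end.
    case: (eqVneq (flip G d) r) => dr.
      suff : is_true (if val (flip GH x) is inl _ then true else false).
        by rewrite val_glue_flip x_eq /= dr eqxx.
      apply: (connect_inv (P := fun z : {x | nonroot r s x} =>
        is_true (if val z is inl _ then true else false))) cx _; last by rewrite x_eq.
      move=> a b /orP[/and3P[/eqP-> ax aox]|/eqP->]; last first.
        by rewrite val_glue_nxt; case: (val a).
      rewrite val_glue_flip; case a_eq: (val a) => [c|c] //= _.
      case: eqP => //= cr; case/negP: ax; apply/eqP/val_inj.
      by rewrite a_eq x_eq; congr inl; apply: (flip_inj tG); rewrite cr dr.
    suff : S (val (flip GH x)).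
      rewrite val_glue_flip x_eq /= (negPf dr) /=.
      exact/negP/(tree_acyclic tG).
    apply: (connect_inv (P := fun z : {x | nonroot r s x} => S (val z))) cx _;
      last by rewrite x_eq /= connect0.
    move=> a b /orP[/and3P[/eqP-> ax aox]|/eqP->]; last first.
      rewrite val_glue_nxt; case: (val a) => //= c h.
      by apply: connect_trans h (connect1 _); rewrite /step_off eqxx orbT.
    rewrite val_glue_flip; case a_eq: (val a) => [c|c] /=.
      case: eqP => [cr|cr] /= h.
        by rewrite -cr (flipK tG).
      apply: connect_trans h (connect1 _); rewrite /step_off eqxx /=.
      apply/orP; left; apply/andP; split.
        by apply: contra ax => /eqP cd; apply/eqP/val_inj; rewrite a_eq x_eq cd.
      apply: contra aox => /eqP cd; apply/eqP/val_inj.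
      by rewrite val_glue_flip a_eq x_eq /= (negPf dr) cd.
    by case: eqP.
  + pose S (z : D + E) := match z with
      | inr a => connect (step_off H e) e a
      | inl b => connect (step_off H e) e (flip H s) end.
    case: (eqVneq (flip H e) s) => dr.
      suff : is_true (if val (flip GH x) is inl _ then false else true).
        by rewrite val_glue_flip x_eq /= dr eqxx.
      apply: (connect_inv (P := fun z : {x | nonroot r s x} =>
        is_true (if val z is inl _ then false else true))) cx _; last by rewrite x_eq.
      move=> a b /orP[/and3P[/eqP-> ax aox]|/eqP->]; last first.
        by rewrite val_glue_nxt; case: (val a).
      rewrite val_glue_flip; case a_eq: (val a) => [c|c] //= _.
      case: eqP => //= cr; case/negP: ax; apply/eqP/val_inj.
      by rewrite a_eq x_eq; congr inr; apply: (flip_inj tH); rewrite cr dr.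
    suff : S (val (flip GH x)).
      rewrite val_glue_flip x_eq /= (negPf dr) /=.
      exact/negP/(tree_acyclic tH).
    apply: (connect_inv (P := fun z : {x | nonroot r s x} => S (val z))) cx _;
      last by rewrite x_eq /= connect0.
    move=> a b /orP[/and3P[/eqP-> ax aox]|/eqP->]; last first.
      rewrite val_glue_nxt; case: (val a) => //= c h.
      by apply: connect_trans h (connect1 _); rewrite /step_off eqxx orbT.
    rewrite val_glue_flip; case a_eq: (val a) => [c|c] /=; last first.
      case: eqP => [cr|cr] /= h.
        by rewrite -cr (flipK tH).
      apply: connect_trans h (connect1 _); rewrite /step_off eqxx /=.
      apply/orP; left; apply/andP; split.
        by apply: contra ax => /eqP cd; apply/eqP/val_inj; rewrite a_eq x_eq cd.
      apply: contra aox => /eqP cd; apply/eqP/val_inj.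
      by rewrite val_glue_flip a_eq x_eq /= (negPf dr) cd.
    by case: eqP.
Qed.

Lemma glue_unrooted : is_unrooted GH.
Proof.
split=> [|x]; first exact: glue_tree.
have [_ _ lG] := rG; have [_ _ lH] := rH.
rewrite /trivalent /= -val_eqE val_glue_nxt; case: x => -[d|e] h /=.
  by rewrite lG (negPf h) orbF.
by rewrite lH (negPf h) orbF.
Qed.

Lemma glue_order : tree_order GH = (tree_order G + tree_order H)%N.
Proof.
apply/eqP; rewrite -(eqn_pmul2r (isT : 0 < 3)%N) mulnDl !tree_order3; last first.
- exact: nxt3 glue_tree.
- exact: nxt3 tG.
- exact: nxt3 tH.
rewrite -(card_image val_inj (trivalent GH)).
rewrite -(card_image (@inl_inj D E) (trivalent G)).
rewrite -(card_image (@inr_inj D E) (trivalent H)).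
have inlE (f : pred D) d : (inl d \in image (@inl D E) f) = (d \in f).
  exact: mem_image (@inl_inj D E) f d.
have inrE (f : pred E) d : (inr d \in image (@inr D E) f) = (d \in f).
  exact: mem_image (@inr_inj D E) f d.
have inlN (f : pred D) d : (inr d \in image (@inl D E) f) = false.
  by apply/negP => /imageP[].
have inrN (f : pred E) d : (inl d \in image (@inr D E) f) = false.
  by apply/negP => /imageP[].
rewrite -cardUI [X in (_ == _ + X)%N]eq_card0 ?addn0; last first.
  by case=> d; rewrite !inE ?inlN ?inrN ?andbF.
apply/eqP/eq_card => z.
have key : (z \in image val (trivalent GH)) = nonroot r s z && (nxt raw z != z).
  apply/imageP/andP => [[x xt ->]|[zn zt]].
    split; first exact: valP.
    by move: xt; rewrite inE /trivalent /= -val_eqE val_glue_nxt.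
  by exists (exist _ z zn) => //; rewrite inE /trivalent /= -val_eqE val_glue_nxt.
rewrite key !inE; case: z {key} => d; rewrite ?inlE ?inrE ?inlN ?inrN ?orbF /=.
  rewrite !inE /trivalent /=; case: (eqVneq d r) => [->|//] /=.
  by rewrite nr eqxx.
rewrite !inE /trivalent /=; case: (eqVneq d s) => [->|//] /=.
by rewrite ns eqxx.
Qed.

End GlueTree.

Section ProdTree.
Context (m : nat) (D E : finType) (G : ugraph m D) (r : D)
  (H : ugraph m E) (s : E) (rG : is_rooted G r) (rH : is_rooted H s).

Let tG : is_tree G. Proof. by case: rG. Qed.
Let tH : is_tree H. Proof. by case: rH. Qed.
Let nr : nxt G r = r. Proof. by case: rG. Qed.
Let ns : nxt H s = s. Proof. by case: rH. Qed.

Let P := prod_graph G r H s.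

Let inG_step a b : step G a b -> connect (step P) (inl (inl a)) (inl (inl b)).
Proof.
case/orP => /eqP->; first by apply/connect1/orP; left.
case: (eqVneq a r) => [->|ar]; first by rewrite nr connect0.
by apply/connect1/orP; right; rewrite /= (negPf ar).
Qed.

Let inH_step a b : step H a b -> connect (step P) (inl (inr a)) (inl (inr b)).
Proof.
case/orP => /eqP->; first by apply/connect1/orP; left.
case: (eqVneq a s) => [->|ar]; first by rewrite ns connect0.
by apply/connect1/orP; right; rewrite /= (negPf ar).
Qed.

Let to_new x : connect (step P) x (inr true).
Proof.
have hs : connect (step P) (inl (inr s)) (inr true).
  by apply/connect1/orP; right; rewrite /= eqxx.
case: x => [[d|e]|[]]; rewrite ?connect0 //.
- apply: connect_trans (connect_hom inG_step (tree_connected tG d r)) _.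
  apply: connect_trans hs; apply/connect1/orP; right; by rewrite /= eqxx.
- exact: connect_trans (connect_hom inH_step (tree_connected tH e s)) hs.
- by apply/connect1/orP; left.
Qed.

Let from_new x : connect (step P) (inr true) x.
Proof.
have hr : connect (step P) (inr true) (inl (inl r)).
  by apply/connect1/orP; right.
case: x => [[d|e]|[]]; rewrite ?connect0 //.
- exact: connect_trans hr (connect_hom inG_step (tree_connected tG r d)).
- apply: connect_trans hr _.
  apply: connect_trans (connect_hom inH_step (tree_connected tH s e)).
  by apply/connect1/orP; right; rewrite /= eqxx.
- by apply/connect1/orP; left.
Qed.

Lemma prod_tree : is_tree P.
Proof.
split.
- by case=> [[d|e]|[]] /=; rewrite ?(flipK tG) ?(flipK tH).
- case=> [[d|e]|[]] //=.
    by rewrite !(inj_eq inl_inj) (flip_neq tG).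
  by rewrite (inj_eq inl_inj) (inj_eq inr_inj) (flip_neq tH).
- case=> [[d|e]|[]] //=; last by rewrite eqxx /= eqxx.
    case: (eqVneq d r) => [->|dr] /=; first by rewrite eqxx.
    rewrite !(negPf (nxt_root_neq tG nr _)) /= ?(nxt_root_neq tG nr) //=.
    by rewrite (nxt3 tG).
  case: (eqVneq e s) => [->|es] /=; first by rewrite eqxx.
  rewrite !(negPf (nxt_root_neq tH ns _)) /= ?(nxt_root_neq tH ns) //=.
  by rewrite (nxt3 tH).
- by apply/card_gt0P; exists (inr true).
- by move=> x y; apply: connect_trans (to_new x) (from_new y).
- case=> [[d|e]|[]]; apply/negP => cx.
  + pose S (z : D + E + bool) := connect (step_off G d) d
      (if z is inl (inl a) then a else r).
    suff : S (flip P (inl (inl d))) by apply/negP/(tree_acyclic tG).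
    apply: (connect_inv (P := fun z => S z)) cx _; last exact: connect0.
    rewrite /S => a b /orP[/and3P[/eqP-> ax aox]|/eqP->]; last first.
      case: a => [[c|c]|[]] //=; last by case: ifP.
      case: ifP => [/eqP -> //|_] h.
      by apply: connect_trans h (connect1 _); rewrite /step_off eqxx orbT.
    case: a ax aox => [[c|c]|[]] //= ax aox h.
    apply: connect_trans h (connect1 _); rewrite /step_off eqxx /=.
    by rewrite !(inj_eq inl_inj) in ax aox; rewrite ax aox.
  + pose S (z : D + E + bool) := connect (step_off H e) e
      (if z is inl (inr a) then a else s).
    suff : S (flip P (inl (inr e))) by apply/negP/(tree_acyclic tH).
    apply: (connect_inv (P := fun z => S z)) cx _; last exact: connect0.
    rewrite /S => a b /orP[/and3P[/eqP-> ax aox]|/eqP->]; last first.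
      case: a => [[c|c]|[]] //=; first by case: ifP.
      case: ifP => [/eqP -> //|_] h.
      by apply: connect_trans h (connect1 _); rewrite /step_off eqxx orbT.
    case: a ax aox => [[c|c]|[]] //= ax aox h.
    apply: connect_trans h (connect1 _); rewrite /step_off eqxx /=.
    by rewrite !(inj_eq inl_inj) !(inj_eq inr_inj) in ax aox; rewrite ax aox.
  + suff : flip P (inr true) != inr false by rewrite eqxx.
    apply: (connect_inv (P := fun z => is_true (z != inr false))) cx _ => //.
    move=> a b /orP[/and3P[/eqP-> ax aox]|/eqP->]; first by case: a ax {aox} => [[]|[]].
    by case: a => [[c|c]|[]] //=; case: ifP.
  + suff : flip P (inr false) == inr false by [].
    apply: (connect_inv (P := fun z => is_true (z == inr false))) cx _ => //.
    move=> a b /orP[/and3P[/eqP-> ax aox]|/eqP->]; last by move/eqP->.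
    by move/eqP => a_eq; rewrite a_eq eqxx in ax.
Qed.

Lemma prod_rooted : is_rooted P (inr false).
Proof.
split=> //; first exact: prod_tree.
have [_ _ lG] := rG; have [_ _ lH] := rH.
case=> [[d|e]|[]] //=; rewrite orbF /trivalent /=.
  by rewrite lG; case: (eqVneq d r) => [->|dr]; rewrite ?orbT ?orbF.
by rewrite lH; case: (eqVneq e s) => [->|dr]; rewrite ?orbT ?orbF.
Qed.

End ProdTree.

Lemma glue_iso m (D D' E E' : finType) (G : ugraph m D) (r : D)
    (G' : ugraph m D') (r' : D') (H : ugraph m E) (s : E)
    (H' : ugraph m E') (s' : E') :
  is_rooted G r -> is_rooted H s -> riso G r G' r' -> riso H s H' s' ->
  iso (glue_graph G r H s) (glue_graph G' r' H' s').
Proof.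
move=> rG rH [f fi fr] [h hi hs].
have rG' : is_rooted G' r' by rewrite -fr; apply: rooted_iso fi rG.
have rH' : is_rooted H' s' by rewrite -hs; apply: rooted_iso hi rH.
have [[g fK gK] fo fn fl] := fi; have [[k hK kK] ho hn hl] := hi.
have fI := can_inj fK; have hI := can_inj hK.
apply: (@restrict_iso _ _ _ _ _ _ _
  (fun x => match x with inl d => inl (f d) | inr e => inr (h e) end)
  (fun x => match x with inl d => inl (g d) | inr e => inr (k e) end)).
- exact: glue_closed.
- exact: glue_closed.
- by case=> d; rewrite -topredE /= ?(inj_eq fI) ?(inj_eq hI) -?fr -?hs ?(inj_eq fI) ?(inj_eq hI).
- by case=> d; rewrite -topredE /= -?fr -?hs; apply: contra => /eqP <-; rewrite ?gK ?kK.
- by case=> d _; rewrite ?fK ?hK.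
- by case=> d _; rewrite ?gK ?kK.
- case=> d _ /=.
    by rewrite -fo -fr (inj_eq fI) -hs -ho; case: ifP.
  by rewrite -ho -hs (inj_eq hI) -fr -fo; case: ifP.
- by case=> d _ /=; rewrite ?fn ?hn.
- by case=> d _ /=.
Qed.

Lemma glue_sym m (D E : finType) (G : ugraph m D) (r : D)
    (H : ugraph m E) (s : E) :
  is_rooted G r -> is_rooted H s ->
  iso (glue_graph G r H s) (glue_graph H s G r).
Proof.
move=> rG rH; apply: (@restrict_iso _ _ _ _ _ _ _
  (fun x => match x with inl d => inr d | inr e => inl e end)
  (fun x => match x with inl d => inr d | inr e => inl e end)).
- exact: glue_closed.
- exact: glue_closed.
- by case.
- by case.
- by case.
- by case.
- by case=> d _ /=; case: ifP.
- by case.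
- by case.
Qed.

Lemma glue_prod m (D E F : finType) (A : ugraph m D) (a : D)
    (B : ugraph m E) (b : E) (C : ugraph m F) (c : F) :
  is_rooted A a -> is_rooted B b -> is_rooted C c ->
  iso (glue_graph (prod_graph A a B b) (inr false) C c)
      (glue_graph A a (prod_graph B b C c) (inr false)).
Proof.
move=> rA rB rC; have [tA nA _] := rA; have [tB nB _] := rB; have [tC nC _] := rC.
apply: (@restrict_iso _ _ _ _ _ _ _
  (fun x : D + E + bool + F => match x with
     | inl (inl (inl d)) => if d == a then inr (inr true) else inl d
     | inl (inl (inr e)) => inr (inl (inl e))
     | inl (inr _) => inr (inl (inr c))
     | inr f => inr (inl (inr f))
   end)
  (fun y : D + (E + F + bool) => match y with
     | inl d => inl (inl (inl d))
     | inr (inl (inl e)) => inl (inl (inr e))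
     | inr (inl (inr f)) => if f == c then inl (inr true) else inr f
     | inr (inr _) => inl (inl (inl a))
   end)).
- by apply: glue_closed => //; apply: prod_rooted.
- by apply: glue_closed => //; apply: prod_rooted.
- by case=> [[[d|e]|[]]|f] //; rewrite -topredE /=; case: (eqVneq d a).
- by case=> [d|[[e|f]|[]]] //; rewrite -topredE /=; case: (eqVneq f c).
- case=> [[[d|e]|[]]|f] //; rewrite -topredE /= ?eqxx //.
    by case: (eqVneq d a) => [->|].
  by move/negPf->.
- case=> [d|[[e|f]|[]]] //; rewrite -topredE /= ?eqxx //.
    by move/negPf->.
  by case: (eqVneq f c) => [->|].
- case=> [[[d|e]|[]]|f] //; rewrite -topredE /= ?eqxx //.
  + case: (eqVneq d a) => [->|da] /=; rewrite ?eqxx ?(negPf (flip_neq tA _)) //.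
  + move/negPf => fc; rewrite ?(inj_eq inr_inj).
    by case: (eqVneq (flip C f) c) => [->|].
- case=> [[[d|e]|[]]|f] //; rewrite -topredE /= ?eqxx ?nA //.
  + case: (eqVneq d a) => [_|da] //=.
    by rewrite (negPf (nxt_root_neq tA nA da)).
  + by case: (eqVneq e b).
  + by move=> /negPf->.
- case=> [[[d|e]|[]]|f] //; rewrite -topredE /= ?eqxx //.
  + case: (eqVneq d a) => [->|da] //= _.
    by have [_ _ /(_ a)] := rA; rewrite eqxx orbT => /eqP.
  + by have [_ _ /(_ c)] := rC; rewrite eqxx orbT => /eqP.
Qed.

Lemma glue_rev m (D E : finType) (G : ugraph m D) (r : D)
    (H : ugraph m E) (s : E) (v : D) :
  is_rooted G r -> is_rooted (rev_at G v) r -> is_rooted H s ->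
  forall vr : trivalent G v,
  exists2 x, trivalent (glue_graph G r H s) x
    & iso (rev_at (glue_graph G r H s) x) (glue_graph (rev_at G v) r H s).
Proof.
move=> rG rG' rH vt; have [tG nr _] := rG.
have vr : nonroot r s (inl v).
  by rewrite /=; apply: contra vt => /eqP ->; rewrite /= nr.
pose x : {x : D + E | nonroot r s x} := exist (nonroot r s) (inl v) vr.
have nxtE y : val (nxt (glue_graph G r H s) y) = nxt (glue_all G r H s) (val y).
  exact: val_glue_nxt.
exists x; first by rewrite /trivalent /= -val_eqE nxtE /= (inj_eq inl_inj).
exists id; split; first by exists id.
- by move=> y; apply: val_inj; rewrite (val_glue_flip rG' rH).
- move=> y; apply: val_inj; rewrite (val_glue_nxt rG' rH).
  have yx : (y \in [:: x; nxt (glue_graph G r H s) x;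
                        nxt (glue_graph G r H s) (nxt (glue_graph G r H s) x)])
          = (val y \in [:: inl v; inl (nxt G v); inl (nxt G (nxt G v))]).
    by rewrite !inE -!val_eqE !nxtE.
  transitivity (if val y \in [:: inl v; inl (nxt G v); inl (nxt G (nxt G v))]
    then nxt (glue_all G r H s) (nxt (glue_all G r H s) (val y))
    else nxt (glue_all G r H s) (val y)).
    by rewrite -yx /=; case: ifP => _; rewrite !nxtE.
  by case: y {yx} => -[d|e] yn //=; rewrite !inE !(inj_eq inl_inj); case: ifP.
- by [].
Qed.

Record utree (m : nat) := UTree {
  usize : nat;
  ugr :> ugraph m 'I_usize;
  utreeP : is_unrooted ugr
}.

Record rtree (m : nat) := RTree {
  rsize : nat;
  rgr :> ugraph m 'I_rsize;
  root : 'I_rsize;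
  rtreeP : is_rooted rgr root
}.

Definition rprod m (I J : rtree m) : rtree m :=
  RTree (rooted_iso (giso_std _) (prod_rooted (rtreeP I) (rtreeP J))).

Definition glue m (I J : rtree m) : utree m :=
  UTree (unrooted_iso (giso_std _) (glue_unrooted (rtreeP I) (rtreeP J))).

Definition same_rtree m (I J : rtree m) : Prop := riso I (root I) J (root J).

(* Up to isomorphism, [u] is [t] with one cyclic ordering reversed; similarly
   [AS_rtree I J] says that [J] is [- I]. *)
Definition AS_utree m (t u : utree m) : Prop :=
  exists2 v, trivalent t v & iso (rev_at t v) u.

Definition AS_rtree m (I J : rtree m) : Prop :=
  exists2 v, trivalent I v & riso (rev_at I v) (root I) J (root J).

(* Cutting an unrooted tree at an edge presents it as [glue S K]; [S] is the
   rooted subtree that is replaced and [K] is the unchanged rest. *)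
Definition IHX_utree m (I H X : utree m) : Prop :=
  exists A B C K : rtree m,
    [/\ iso I (glue (rprod A (rprod B C)) K),
        iso H (glue (rprod (rprod A B) C) K)
      & iso X (glue (rprod (rprod A C) B) K)].

(* In a rooted tree the replaced rooted subtree is reached by descending through
   rooted products. *)
Inductive IHX_rtree m : rtree m -> rtree m -> rtree m -> Prop :=
| IHX_top A B C :
    IHX_rtree (rprod A (rprod B C)) (rprod (rprod A B) C) (rprod (rprod A C) B)
| IHX_left I H X J :
    IHX_rtree I H X -> IHX_rtree (rprod I J) (rprod H J) (rprod X J)
| IHX_right I H X J :
    IHX_rtree I H X -> IHX_rtree (rprod J I) (rprod J H) (rprod J X)
| IHX_same I H X I' H' X' :
    same_rtree I I' -> same_rtree H H' -> same_rtree X X' ->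
    IHX_rtree I H X -> IHX_rtree I' H' X'.

Record utree_of (m n : nat) := UTreeOf {
  uval :> utree m;
  uorderP : tree_order uval = n
}.

Record rtree_of (m n : nat) := RTreeOf {
  rval :> rtree m;
  rorderP : tree_order rval = n
}.

Lemma glue_orderE m n (I J : rtree_of m n) : tree_order (glue I J) = (2 * n)%N.
Proof.
have gt := glue_tree (rtreeP I) (rtreeP J).
rewrite /= (giso_order (giso_std _) gt) (glue_order (rtreeP I) (rtreeP J)).
by rewrite !rorderP mul2n addnn.
Qed.

Definition glue_of m n (I J : rtree_of m n) : utree_of m (2 * n) :=
  UTreeOf (glue_orderE I J).

Inductive zspan (V : zmodType) (R : V -> Prop) : V -> Prop :=
| zspan0 : zspan R 0
| zspan_gen x : R x -> zspan R x
| zspanB x y : zspan R x -> zspan R y -> zspan R (x - y).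

Definition zspan_pred (V : zmodType) (R : V -> Prop) : {pred V} :=
  fun x => `[< zspan R x >].

Lemma zspan_zmod_closed (V : zmodType) (R : V -> Prop) :
  zmod_closed (zspan_pred R).
Proof.
split=> [|x y /asboolP Rx /asboolP Ry]; apply/asboolP; first exact: zspan0.
exact: zspanB.
Qed.

HB.instance Definition _ (V : zmodType) (R : V -> Prop) :=
  GRing.isZmodClosed.Build V (zspan_pred R) (zspan_zmod_closed R).

Definition zquot (V : zmodType) (R : V -> Prop) : zmodType :=
  Quotient.quot (zspan_pred R : zmodClosed V).

Definition zpi (V : zmodType) (R : V -> Prop) : V -> zquot R :=
  fun x => (\pi_(zquot R) x)%qT.

Lemma zpi_is_zmod_morphism (V : zmodType) (R : V -> Prop) :
  zmod_morphism (zpi R).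
Proof. exact: (@pi_is_zmod_morphism V _ _ (Quotient.quot (zspan_pred R : zmodClosed V))). Qed.

HB.instance Definition _ (V : zmodType) (R : V -> Prop) :=
  GRing.isZmodMorphism.Build V (zquot R) (zpi R) (zpi_is_zmod_morphism R).

Definition zrepr (V : zmodType) (R : V -> Prop) (x : zquot R) : V := repr x.

Lemma zpi_repr (V : zmodType) (R : V -> Prop) (x : zquot R) :
  zpi R (zrepr x) = x.
Proof. exact: reprK. Qed.

Lemma zpi_eq0 (V : zmodType) (R : V -> Prop) x : zpi R x = 0 <-> zspan R x.
Proof.
rewrite -(raddf0 (zpi R)); split=> [/eqP|Rx].
  by rewrite /zpi -Quotient.idealrBE subr0 => /asboolP.
by apply/eqP; rewrite /zpi -Quotient.idealrBE subr0; apply/asboolP.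
Qed.

Lemma zpi_rel (V : zmodType) (R : V -> Prop) x : R x -> zpi R x = 0.
Proof. by move=> Rx; apply/zpi_eq0/zspan_gen. Qed.

Lemma zspan_ker (V M : zmodType) (R : V -> Prop) (g : {additive V -> M}) :
  (forall x, R x -> g x = 0) -> forall x, zspan R x -> g x = 0.
Proof.
move=> gR x; elim=> [|//|y z _ gy _ gz]; first by rewrite raddf0.
by rewrite raddfB gy gz subr0.
Qed.

Lemma zspan_repr (V : zmodType) (R : V -> Prop) (x : V) :
  zspan R (zrepr (zpi R x) - x).
Proof. by apply/zpi_eq0; rewrite raddfB /= zpi_repr subrr. Qed.

Lemma zspan_reprB (V : zmodType) (R : V -> Prop) (x y : zquot R) :
  zspan R (zrepr (x - y) - (zrepr x - zrepr y)).
Proof. by apply/zpi_eq0; rewrite !(raddfB (zpi R)) /= !zpi_repr subrr. Qed.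

Definition zlift (V M : zmodType) (R : V -> Prop) (g : V -> M) : zquot R -> M :=
  fun x => g (zrepr x).

Lemma zliftE (V M : zmodType) (R : V -> Prop) (g : {additive V -> M}) :
  (forall x, R x -> g x = 0) -> forall x, zlift g (zpi R x) = g x.
Proof.
move=> gR x; apply/eqP; rewrite -subr_eq0 -raddfB; apply/eqP.
exact: (zspan_ker gR) (zspan_repr _ _).
Qed.

Lemma zlift_is_zmod_morphism (V M : zmodType) (R : V -> Prop)
    (g : {additive V -> M}) :
  (forall x, R x -> g x = 0) -> zmod_morphism (zlift (R := R) g).
Proof.
move=> gR x y; apply/eqP; rewrite -subr_eq0 /zlift -!(raddfB g); apply/eqP.
exact: (zspan_ker gR) (zspan_reprB _ _).
Qed.

Notation free_ab K := {freeg {classic K} / int}.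

Definition fgen (K : Type) (k : K) : free_ab K :=
  [freeg [:: (1, (k : {classic K}))]].

Definition flift (K : Type) (M : zmodType) (f : K -> M) (x : free_ab K) : M :=
  \sum_(k <- dom x) f k *~ coeff k x.

Lemma flift_fglift (K : Type) (M : zmodType) (f : K -> M) x :
  flift f x = fglift (f : {classic K} -> zmodule M) x.
Proof.
set g := fglift _; have gB : zmod_morphism g := lift_is_additive _.
have g0 : g 0 = 0 by rewrite -(subrr 0) gB subrr.
have gD : {morph g : u v / u + v}.
  by move=> u v; rewrite -[v in LHS]opprK -[- v]sub0r !gB g0 sub0r opprK.
rewrite -[x in RHS]freeg_sumE (big_morph g gD g0); apply: eq_bigr => k _.
by rewrite /g liftU.
Qed.

Lemma flift_is_zmod_morphism (K : Type) (M : zmodType) (f : K -> M) :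
  zmod_morphism (flift f).
Proof. by move=> x y; rewrite !flift_fglift; exact: (lift_is_additive (f : {classic K} -> zmodule M) x y). Qed.

HB.instance Definition _ (K : Type) (M : zmodType) (f : K -> M) :=
  GRing.isZmodMorphism.Build (free_ab K) M (flift f) (flift_is_zmod_morphism f).

Lemma flift_gen (K : Type) (M : zmodType) (f : K -> M) k :
  flift f (fgen k) = f k.
Proof. by rewrite flift_fglift liftU scale1r. Qed.

Definition bilift (K : Type) (M : zmodType) (f : K -> K -> M) (x y : free_ab K) :=
  flift (fun k => flift (f k) y) x.

Lemma biliftC (K : Type) (M : zmodType) (f : K -> K -> M) :
  (forall k l, f k l = f l k) -> forall x y, bilift f x y = bilift f y x.
Proof.
move=> fC x y; rewrite /bilift /flift.
under eq_bigr do rewrite mulrz_suml.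
rewrite exchange_big; apply: eq_bigr => k _; rewrite mulrz_suml.
by apply: eq_bigr => l _; rewrite fC -!mulrzA mulrC.
Qed.

Lemma biliftBl (K : Type) (M : zmodType) (f : K -> K -> M) x y z :
  bilift f (x - y) z = bilift f x z - bilift f y z.
Proof. exact: raddfB. Qed.

(* Generators are concrete trees, so isomorphic ones are identified by a
   relation. *)
Variant tree_rel m n : free_ab (utree_of m n) -> Prop :=
| tree_rel_same (t u : utree_of m n) :
    iso t u -> tree_rel (fgen t - fgen u)
| tree_rel_AS (t u : utree_of m n) :
    AS_utree t u -> tree_rel (fgen t + fgen u)
| tree_rel_IHX (I H X : utree_of m n) :
    IHX_utree I H X -> tree_rel (fgen I - fgen H + fgen X).

(* T_n *)
Definition treeG m n : zmodType := zquot (@tree_rel m n).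
Definition utr m n (t : utree_of m n) : treeG m n := zpi _ (fgen t).

(* L'_{n+1}, generated by the rooted trees of order n *)
Variant quasiLie_rel m n : free_ab (rtree_of m n) -> Prop :=
| quasiLie_rel_same (I J : rtree_of m n) :
    same_rtree I J -> quasiLie_rel (fgen I - fgen J)
| quasiLie_rel_AS (I J : rtree_of m n) :
    AS_rtree I J -> quasiLie_rel (fgen I + fgen J)
| quasiLie_rel_IHX (I H X : rtree_of m n) :
    IHX_rtree I H X -> quasiLie_rel (fgen I - fgen H + fgen X).

Definition quasiLie m n : zmodType := zquot (@quasiLie_rel m n).
Definition rtr m n (J : rtree_of m n) : quasiLie m n := zpi _ (fgen J).

Definition glue_tr m n (I J : rtree_of m n) : treeG m (2 * n) := utr (glue_of I J).

(* The quotient of T_{2n} (+) Z[J^oo] by the additional relations J^oo = (- J)^oo,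
   2 J^oo = <J, J> and I^oo = H^oo + X^oo - <H, X>. *)
Variant twisted_rel m n : treeG m (2 * n) * free_ab (rtree_of m n) -> Prop :=
| twisted_rel_same (I J : rtree_of m n) :
    same_rtree I J -> twisted_rel (0, fgen I - fgen J)
| twisted_rel_sym (I J : rtree_of m n) :
    AS_rtree I J -> twisted_rel (0, fgen I - fgen J)
| twisted_rel_double (J : rtree_of m n) :
    twisted_rel (- glue_tr J J, fgen J *+ 2)
| twisted_rel_IHX (I H X : rtree_of m n) :
    IHX_rtree I H X ->
    twisted_rel (glue_tr H X, fgen I - fgen H - fgen X).

(* T^oo_{2n} *)
Definition treeG_inf m n : zmodType := zquot (@twisted_rel m n).
Definition inf_utr m n (t : utree_of m (2 * n)) : treeG_inf m n :=
  zpi _ (utr t, 0).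
Definition inf_rtr m n (J : rtree_of m n) : treeG_inf m n := zpi _ (0, fgen J).

Record symform (A M : zmodType) := SymForm {
  sform :> A -> A -> M;
  sformC : forall a b, sform a b = sform b a;
  sformDl : forall a b c, sform (a + b) c = sform a c + sform b c
}.

Lemma utr_same m n (t u : utree_of m n) : iso t u -> utr t = utr u.
Proof.
move=> tu; apply/eqP; rewrite -subr_eq0 -raddfB; apply/eqP/zpi_rel.
exact: tree_rel_same.
Qed.

Lemma utr_AS m n (t u : utree_of m n) : AS_utree t u -> utr t + utr u = 0.
Proof. by move=> tu; rewrite -raddfD; apply/zpi_rel/tree_rel_AS. Qed.

Lemma utr_IHX m n (I H X : utree_of m n) :
  IHX_utree I H X -> utr I - utr H + utr X = 0.
Proof. by move=> IHX; rewrite -raddfB -raddfD; apply/zpi_rel/tree_rel_IHX. Qed.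

Lemma riso_sym m (D E : finType) (G : ugraph m D) r (H : ugraph m E) s :
  riso G r H s -> riso H s G r.
Proof. by case=> f /giso_sym[g gi fg] <-; exists g. Qed.

Lemma same_rtree_refl m (J : rtree m) : same_rtree J J.
Proof. by exists id => //; apply: giso_refl. Qed.

Lemma glue_graph_std m (I J : rtree m) :
  iso (glue_graph I (root I) J (root J)) (glue I J).
Proof. by exists enum_rank; apply: giso_std. Qed.

Lemma glue_same m (I J I' J' : rtree m) :
  same_rtree I I' -> same_rtree J J' -> iso (glue I J) (glue I' J').
Proof.
move=> II' JJ'; apply: iso_trans (iso_sym (glue_graph_std I J)) _.
apply: iso_trans (glue_graph_std I' J').
exact: glue_iso (rtreeP I) (rtreeP J) II' JJ'.
Qed.

Lemma glueC m (I J : rtree m) : iso (glue I J) (glue J I).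
Proof.
apply: iso_trans (iso_sym (glue_graph_std I J)) _.
apply: iso_trans (glue_graph_std J I).
exact: glue_sym (rtreeP I) (rtreeP J).
Qed.

Lemma glueA m (A B C : rtree m) :
  iso (glue (rprod A B) C) (glue A (rprod B C)).
Proof.
have pAB := prod_rooted (rtreeP A) (rtreeP B).
have pBC := prod_rooted (rtreeP B) (rtreeP C).
have sAB : riso (prod_graph A (root A) B (root B)) (inr false)
  (rprod A B) (root (rprod A B)) by exists enum_rank => //; apply: giso_std.
have sBC : riso (prod_graph B (root B) C (root C)) (inr false)
  (rprod B C) (root (rprod B C)) by exists enum_rank => //; apply: giso_std.
apply: iso_trans (iso_sym (glue_graph_std _ _)) _.
apply: iso_trans (glue_graph_std _ _).
apply: iso_trans (iso_sym (glue_iso pAB (rtreeP C) sAB (same_rtree_refl C))) _.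
apply: iso_trans (glue_iso (rtreeP A) pBC (same_rtree_refl A) sBC).
exact: glue_prod (rtreeP A) (rtreeP B) (rtreeP C).
Qed.

Lemma glue_rot m (A B C : rtree m) :
  iso (glue (rprod A B) C) (glue B (rprod C A)).
Proof.
apply: iso_trans (glueC _ _) _; apply: iso_trans (iso_sym (glueA _ _ _)) _.
exact: glueC.
Qed.

Lemma giso_rev m (D E : finType) (G : ugraph m D) (H : ugraph m E) f v :
  giso G H f -> giso (rev_at G v) (rev_at H (f v)) f.
Proof.
move=> [bf fo fn fl]; split=> // d /=.
rewrite -!fn !inE !(inj_eq (bij_inj bf)); case: ifP => _; by rewrite -?fn.
Qed.

Lemma glue_AS m (I J K : rtree m) :
  AS_rtree I J -> AS_utree (glue I K) (glue J K).
Proof.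
case=> v vt IJ; have [f fi fr] := riso_sym IJ.
have rI : is_rooted (rev_at I v) (root I).
  by rewrite -fr; apply: rooted_iso fi (rtreeP J).
have [x xt xi] := glue_rev (rtreeP I) rI (rtreeP K) vt.
have [g gi] := glue_graph_std I K.
exists (g x); first by rewrite (giso_trivalent _ gi).
have ri : iso (rev_at (glue I K) (g x))
              (rev_at (glue_graph I (root I) K (root K)) x).
  by apply: iso_sym; exists g; apply: giso_rev.
apply: iso_trans ri (iso_trans xi _).
apply: iso_trans (glue_graph_std J K).
exact: glue_iso rI (rtreeP K) IJ (same_rtree_refl K).
Qed.

Lemma IHX_utree_iso m (I H X I' H' X' : utree m) :
  iso I I' -> iso H H' -> iso X X' -> IHX_utree I H X -> IHX_utree I' H' X'.
Proof.
move=> iI iH iX [A [B [C [K [hI hH hX]]]]]; exists A, B, C, K.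
split; [exact: iso_trans (iso_sym iI) hI | exact: iso_trans (iso_sym iH) hH
  | exact: iso_trans (iso_sym iX) hX].
Qed.

Lemma glue_IHX m (I H X K : rtree m) :
  IHX_rtree I H X -> IHX_utree (glue I K) (glue H K) (glue X K).
Proof.
move=> r; elim: r K => {I H X}
  [A B C|I H X J _ IH|I H X J _ IH|I H X I' H' X' sI sH sX _ IH] K.
- by exists A, B, C, K; split; apply: iso_refl.
- apply: IHX_utree_iso (IH (rprod J K)); apply: iso_sym; exact: glueA.
- apply: IHX_utree_iso (IH (rprod K J)); apply: iso_sym; exact: glue_rot.
- apply: IHX_utree_iso (IH K); exact: glue_same (same_rtree_refl K).
Qed.

Lemma glue_trC m n (I J : rtree_of m n) : glue_tr I J = glue_tr J I.
Proof. by apply: utr_same; apply: glueC. Qed.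

Lemma glue_tr_rel m n (J : rtree_of m n) (x : free_ab (rtree_of m n)) :
  quasiLie_rel x -> flift (fun I => glue_tr I J) x = 0.
Proof.
case=> [I I' II'|I I' II'|I H X IHX].
- rewrite raddfB /= !flift_gen; apply/eqP; rewrite subr_eq0; apply/eqP/utr_same.
  exact: glue_same (same_rtree_refl J).
- by rewrite raddfD /= !flift_gen; apply: utr_AS; apply: glue_AS.
- rewrite raddfD raddfB /= !flift_gen.
  by apply: utr_IHX; apply: glue_IHX.
Qed.

Definition glue_free m n : free_ab (rtree_of m n) -> free_ab (rtree_of m n) ->
  treeG m (2 * n) := bilift (@glue_tr m n).

Lemma glue_free_ker m n (x y : free_ab (rtree_of m n)) :
  zspan (@quasiLie_rel m n) x -> glue_free x y = 0.
Proof.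
elim=> [|{}x Rx|u v _ hu _ hv]; first exact: raddf0.
  rewrite /glue_free (biliftC (@glue_trC m n)) /bilift /flift.
  apply: big1 => J _; rewrite -/(flift _ _).
  under [flift _ _]eq_bigr do rewrite glue_trC.
  by rewrite -/(flift (fun I => glue_tr I J) x) glue_tr_rel // mul0rz.
by rewrite /glue_free biliftBl -!/(glue_free _ _) hu hv subr0.
Qed.

Definition glue_lie m n (a b : quasiLie m n) : treeG m (2 * n) :=
  glue_free (zrepr a) (zrepr b).

Lemma glue_free_eq m n (x x' y : free_ab (rtree_of m n)) :
  zspan (@quasiLie_rel m n) (x - x') -> glue_free x y = glue_free x' y.
Proof.
move=> h; apply/eqP; rewrite -subr_eq0 /glue_free -biliftBl; apply/eqP.
exact: glue_free_ker.
Qed.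

Lemma glue_lieC m n (a b : quasiLie m n) : glue_lie a b = glue_lie b a.
Proof. exact: biliftC (@glue_trC m n) _ _. Qed.

Lemma glue_lieDl m n (a b c : quasiLie m n) :
  glue_lie (a + b) c = glue_lie a c + glue_lie b c.
Proof.
rewrite /glue_lie -[RHS](raddfD (flift _)); apply: glue_free_eq.
by apply/zpi_eq0; rewrite raddfB raddfD /= !zpi_repr subrr.
Qed.

Definition glue_form m n : symform (quasiLie m n) (treeG m (2 * n)) :=
  SymForm (@glue_lieC m n) (@glue_lieDl m n).

Lemma glue_formE m n (I J : rtree_of m n) :
  glue_form m n (rtr I) (rtr J) = glue_tr I J.
Proof.
rewrite /= /glue_lie (glue_free_eq _ (zspan_repr _ _)).
rewrite /glue_free (biliftC (@glue_trC m n)) -/(glue_free _ _).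
rewrite (glue_free_eq _ (zspan_repr _ _)).
by rewrite /glue_free /bilift !flift_gen glue_trC.
Qed.

Record sqgroup := SQGroup {
  sq_e : zmodType;
  sq_ee : zmodType;
  sq_h : {additive sq_e -> sq_ee};
  sq_p : {additive sq_ee -> sq_e};
  sq_hp : forall x, sq_h (sq_p x) = x *+ 2;
  sq_ph : forall y, sq_p (sq_h y) = y *+ 2
}.

Record sqhom (M N : sqgroup) := SQHom {
  hom_e : {additive sq_e M -> sq_e N};
  hom_ee : {additive sq_ee M -> sq_ee N};
  hom_h : forall x, hom_ee (sq_h M x) = sq_h N (hom_e x);
  hom_p : forall y, hom_e (sq_p M y) = sq_p N (hom_ee y)
}.

Definition sqiso (M N : sqgroup) (F : sqhom M N) : Prop :=
  bijective (hom_e F) /\ bijective (hom_ee F).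

Definition extension (A M : zmodType) (l : symform A M) : Type := (M * A)%type.

Section Extension.
Context (A M : zmodType) (l : symform A M).
Local Notation ext := (extension l).

Lemma sformDr a b c : l a (b + c) = l a b + l a c.
Proof. by rewrite ![l a _]sformC sformDl. Qed.

Lemma sform0l a : l 0 a = 0.
Proof. by apply: (addrI (l 0 a)); rewrite -sformDl !addr0. Qed.

Lemma sform0r a : l a 0 = 0.
Proof. by rewrite sformC sform0l. Qed.

Lemma sformNl a b : l (- a) b = - l a b.
Proof. by apply: (addrI (l a b)); rewrite -sformDl !subrr sform0l. Qed.

Lemma sformNr a b : l a (- b) = - l a b.
Proof. by rewrite sformC sformNl sformC. Qed.

HB.instance Definition _ := Choice.copy ext (M * A)%type.

Definition ext_add (x y : ext) : ext := (x.1 + y.1 - l x.2 y.2, x.2 + y.2).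
Definition ext_opp (x : ext) : ext := (- x.1 - l x.2 x.2, - x.2).
Definition ext_zero : ext := (0, 0).

Lemma ext_addA : associative ext_add.
Proof.
move=> x y z; rewrite /ext_add /= sformDr sformDl !addrA; congr (_, _).
rewrite !opprD !addrA [in RHS](addrAC _ (- l x.2 y.2) z.1).
by rewrite [in LHS](addrAC _ (- l y.2 z.2) (- l x.2 y.2)) [LHS]addrAC.
Qed.

Lemma ext_addC : commutative ext_add.
Proof.
by move=> x y; rewrite /ext_add sformC [x.1 + _]addrC [x.2 + _]addrC.
Qed.

Lemma ext_add0 : left_id ext_zero ext_add.
Proof. by case=> x a; rewrite /ext_add /= sform0l !add0r subr0. Qed.

Lemma ext_addN : left_inverse ext_zero ext_opp ext_add.
Proof.
case=> x a; rewrite /ext_add /ext_opp /= sformNl opprK.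
by congr (_, _); rewrite ?addNr // addrAC subrK addNr.
Qed.

HB.instance Definition _ :=
  GRing.isZmodule.Build ext ext_addA ext_addC ext_add0 ext_addN.

(* (- 2 l(a, a), - 2 a) = 0 *)
Variant univ_rel : ext -> Prop :=
| UnivRel a : univ_rel (- (l a a *+ 2), - (a *+ 2)).

Definition univ_e : zmodType := zquot univ_rel.

Definition univ_p (x : M) : univ_e := zpi univ_rel ((x, 0) : ext).

Lemma univ_p_is_zmod_morphism : zmod_morphism univ_p.
Proof.
move=> x y; rewrite /univ_p -raddfB; congr zpi.
by congr (_, _); rewrite /= ?sform0r ?sform0l ?oppr0 ?subr0 ?addr0.
Qed.

HB.instance Definition _ :=
  GRing.isZmodMorphism.Build M univ_e univ_p univ_p_is_zmod_morphism.

Definition ext_h (x : ext) : M := x.1 *+ 2 + l x.2 x.2.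

Lemma ext_h_is_zmod_morphism : zmod_morphism ext_h.
Proof.
have hD x y : ext_h (x + y) = ext_h x + ext_h y.
  rewrite /ext_h /= sformDl !sformDr [l y.2 x.2]sformC mulrnBl mulrnDl.
  rewrite [l x.2 y.2 + l y.2 y.2]addrC [in LHS](addrACA (l x.2 x.2)) -mulr2n.
  by rewrite [_ + l x.2 y.2 *+ 2]addrC [LHS]addrA subrK addrACA.
by move=> x y; apply: (addIr (ext_h y)); rewrite -hD !subrK.
Qed.

HB.instance Definition _ :=
  GRing.isZmodMorphism.Build ext M ext_h ext_h_is_zmod_morphism.

Lemma ext_h_rel x : univ_rel x -> ext_h x = 0.
Proof.
case=> a; rewrite /ext_h /= sformNl sformNr opprK.
rewrite [a *+ 2]mulr2n sformDl sformDr -!mulr2n mulNrn.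
exact: addNr.
Qed.

Definition univ_h : univ_e -> M := zlift ext_h.

HB.instance Definition _ :=
  GRing.isZmodMorphism.Build univ_e M univ_h (zlift_is_zmod_morphism ext_h_rel).

Lemma univ_hE (x : ext) : univ_h (zpi univ_rel x) = x.1 *+ 2 + l x.2 x.2.
Proof. exact: zliftE ext_h_rel x. Qed.

Lemma univ_hp x : univ_h (univ_p x) = x *+ 2.
Proof. by rewrite univ_hE /= sform0l addr0. Qed.

Lemma univ_ph y : univ_p (univ_h y) = y *+ 2.
Proof.
rewrite -[y]zpi_repr; case: (zrepr y) => x a; rewrite univ_hE /=.
have r : univ_rel (((x *+ 2 + l a a, 0) : ext) - ((x, a) : ext) *+ 2).
  suff -> : ((x *+ 2 + l a a, 0) : ext) - ((x, a) : ext) *+ 2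
    = (- (l a a *+ 2), - (a *+ 2)) by [].
  rewrite !mulr2n; congr (_, _); rewrite /= ?sform0l ?add0r //.
  rewrite subr0 sformDl !sformDr opprB addrA.
  have -> : x + x + l a a + (l a a - (x + x)) = l a a + l a a.
    by rewrite addrC addrA subrK.
  by rewrite opprD addrA subrr sub0r.
move/zpi_rel/eqP: r; rewrite raddfB subr_eq0 raddfMn => /eqP; exact.
Qed.

Definition univ_group : sqgroup := @SQGroup univ_e M univ_h univ_p univ_hp univ_ph.

(* The universal quadratic refinement of [l]. *)
Definition univ_mu (a : A) : univ_e := zpi univ_rel ((0, a) : ext).

End Extension.

(* Main.v *)
Require Import Defs.
From HB Require Import structures.
From mathcomp Require Import all_boot all_order all_algebra.
From mathcomp Require Import boolp freeg.

Set Implicit Arguments.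
Unset Strict Implicit.
Unset Printing Implicit Defensive.

Import GRing.Theory.
Local Open Scope ring_scope.

(** Both groups are presented by the same kind of data.  Relative to the
    bilinear form, a map is quadratic if its failure to be additive is the
    image of the form, and the universal group is generated by the image of
    the trees and the values of a quadratic map [mu] with [mu(a) *+ 2] equal
    to the image of [l a a].

    From the twisted trees to the universal group, [J^oo] is sent to
    [mu(J)]: the twisted relations hold because [mu] is even, and because
    expanding [mu(H - X)] produces the term [- <H, X>] of the twisted IHX
    relation ([tree_inf_to_univ]).

    For the inverse, [J |-> J^oo] has to be extended to a quadratic map [q] on
    the whole quasi-Lie group, although it is only known on generators.  A
    quadratic map on [A] with values in [N] is the same thing as a splitting
    of the abelian extension of [A] by [N] with the cocycle given by the form:
    [a |-> (- q a, a)] is additive exactly when [q] is quadratic.  So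
    [refines_exists] obtains [q] as an additive map out of a group given by
    generators and relations, and only has to check the relations.  They are AS
    and IHX, which in the extension become the twisted AS and IHX relations
    combined with [2 J^oo = <J, J>] ([inf_quad_exists]).  The universal property
    [univ_lift] then turns [q] into a homomorphism.

    Two quadratic maps with the same form differ by an additive map, so they
    agree as soon as they agree on generators ([refines_ext]).  This gives
    [q a *+ 2 = <a, a>] for all [a], and that the two homomorphisms are mutually
    inverse.  The map [h] on twisted trees is transported from the universal
    group, and so are the identities [h (p x) = x *+ 2] and
    [p (h y) = y *+ 2]. *)

(** * Additive and quadratic maps out of groups given by generators *)

Lemma zmod_morphismD (U V : zmodType) (f : U -> V) :
  (forall x y, f (x + y) = f x + f y) -> zmod_morphism f.
Proof. by move=> fD x y; apply: (addIr (f y)); rewrite -fD !subrK. Qed.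

Lemma fgen_ext (K : Type) (M : zmodType) (f g : {additive free_ab K -> M}) :
  (forall k, f (fgen k) = g (fgen k)) -> f =1 g.
Proof.
move=> fg x; rewrite -[x]freeg_sumE !raddf_sum; apply: eq_bigr => k _.
have -> : << coeff k x *g k >> = fgen (k : K) *~ coeff k x.
  by rewrite /fgen freegU_mulz intz.
by rewrite !raddfMz fg.
Qed.

(** Additivity is a hypothesis on bare functions because the lemma is applied to
    maps without a canonical additive structure, such as the difference of two
    quadratic maps. *)
Lemma zpi_ext (K : Type) (M : zmodType) (R : free_ab K -> Prop)
    (f g : zquot R -> M) : zmod_morphism f -> zmod_morphism g ->
  (forall k, f (zpi R (fgen k)) = g (zpi R (fgen k))) -> f =1 g.
Proof.
move=> fB gB fg x; rewrite -[x]zpi_repr.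
pose f' : {additive zquot R -> M} :=
  HB.pack_for {additive zquot R -> M} f (GRing.isZmodMorphism.Build _ _ f fB).
pose g' : {additive zquot R -> M} :=
  HB.pack_for {additive zquot R -> M} g (GRing.isZmodMorphism.Build _ _ g gB).
exact: (fgen_ext (f := f' \o zpi R) (g := g' \o zpi R)).
Qed.

Definition refines (A N : zmodType) (b : A -> A -> N) (q : A -> N) : Prop :=
  forall x y, q (x + y) = q x + q y + b x y.

(** The difference of two quadratic maps with the same form is additive. *)
Lemma refines_ext (K : Type) (N : zmodType) (R : free_ab K -> Prop)
    (b : zquot R -> zquot R -> N) (q q' : zquot R -> N) :
  refines b q -> refines b q' ->
  (forall k, q (zpi R (fgen k)) = q' (zpi R (fgen k))) -> q =1 q'.
Proof.
move=> qb qb' qq' x; apply/eqP; rewrite -subr_eq0; apply/eqP.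
pose d y := q y - q' y; rewrite -/(d x).
apply: (zpi_ext (f := d) (g := fun=> 0)) x => [|y z|k].
- apply: zmod_morphismD => y z.
  by rewrite /d qb qb' opprD addrACA subrr addr0 opprD addrACA.
- by rewrite subr0.
- by rewrite /d qq' subrr.
Qed.

(** The sign makes [a |-> (- q a, a)] additive for the addition
    [(x, a) + (y, b) = (x + y - l a b, a + b)] exactly when [q] refines [l]. *)
Definition quad_graph (K : Type) (N : zmodType) (R : free_ab K -> Prop)
  (l : symform (zquot R) N) (c : K -> N) (k : K) : extension l :=
  (- c k, zpi R (fgen k)).

(** A quadratic map is a splitting of the extension, hence an ordinary additive
    map, which can be prescribed on generators.  The hypothesis says that the
    prescribed values respect the relations inside the extension. *)
Lemma refines_exists (K : Type) (N : zmodType) (R : free_ab K -> Prop)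
    (l : symform (zquot R) N) (c : K -> N) :
  (forall r, R r -> flift (quad_graph l c) r = 0) ->
  exists2 q : zquot R -> N,
    refines l q & forall k, q (zpi R (fgen k)) = c k.
Proof.
set g := quad_graph l c; move=> gR.
pose s : zquot R -> extension l := zlift (flift g).
have sB : zmod_morphism s := zlift_is_zmod_morphism gR.
have s_gen k : s (zpi R (fgen k)) = g k by rewrite /s (zliftE gR) /= flift_gen.
have s_sec x : (s x).2 = x.
  by apply: (zpi_ext (f := fun x => (s x).2) (g := id)) x => [x y||k] //;
    rewrite ?sB ?s_gen.
exists (fun x => - (s x).1) => [x y|k]; last by rewrite s_gen /= opprK.
have -> : s (x + y) = s x + s y.
  by rewrite -{2}[x](addrK y) sB subrK.
by rewrite /= !s_sec !opprD opprK.
Qed.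

(** The form with values in [N] whose extension contains the graphs of the
    [N]-valued refinements of [l]. *)
Definition push_form (A M N : zmodType) (l : symform A M)
    (p : {additive M -> N}) : symform A N.
Proof.
exists (fun a b => p (l a b)) => [a b|a b c]; first by rewrite sformC.
by rewrite sformDl raddfD.
Defined.

Lemma push_formE (A M N : zmodType) (l : symform A M) (p : {additive M -> N})
  a b : push_form l p a b = p (l a b).
Proof. by []. Qed.

Lemma ext_addE (A M : zmodType) (l : symform A M) x a y b :
  ((x, a) : extension l) + ((y, b) : extension l)
    = ((x + y - l a b, a + b) : extension l).
Proof. by []. Qed.

(** * The universal refinement *)

Section Universal.
Context (A M : zmodType) (l : symform A M).

Lemma univ_muD : refines (fun a b => univ_p l (l a b)) (univ_mu l).
Proof.
move=> a b; rewrite /univ_mu /univ_p -!raddfD; congr zpi.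
by congr (_, _); rewrite /= ?sform0r ?subr0 ?subrK addr0.
Qed.

Lemma univ_h_mu a : univ_h (univ_mu l a) = l a a.
Proof. by rewrite /univ_mu univ_hE /= mul0rn add0r. Qed.

Lemma univ_mu2 a : univ_mu l a *+ 2 = univ_p l (l a a).
Proof. by rewrite -univ_ph univ_h_mu. Qed.

Lemma univ_muN a : univ_mu l (- a) = univ_mu l a.
Proof.
have mu0 : univ_mu l 0 = 0 by apply: (raddf0 (zpi (univ_rel (l := l)))).
apply: (addrI (univ_mu l a)); apply: (addIr (univ_p l (l a (- a)))).
by rewrite -univ_muD subrr mu0 -mulr2n univ_mu2 sformNr raddfN subrr.
Qed.

Lemma univ_decomp (x : M) (a : A) :
  zpi (univ_rel (l := l)) ((x, a) : extension l) = univ_p l x + univ_mu l a.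
Proof.
rewrite /univ_mu /univ_p -raddfD; congr zpi.
by congr (_, _); rewrite /= ?sform0l ?addr0 ?subr0 ?add0r.
Qed.

(** The map sends [[x, a]] to [p x + q a].  It kills the relation
    [(- 2 l a a, - 2 a)] since [q (- 2 a) = q (- a) *+ 2 + p (l a a)], both
    terms of which are [p (l a a)]. *)
Lemma univ_lift (N : zmodType) (p : {additive M -> N}) (q : A -> N) :
  refines (fun a b => p (l a b)) q -> (forall a, q a *+ 2 = p (l a a)) ->
  exists f : {additive univ_e l -> N},
    (forall x, f (univ_p l x) = p x) /\ (forall a, f (univ_mu l a) = q a).
Proof.
move=> qD q2.
pose f0 (y : extension l) : N := p y.1 + q y.2.
have f0B : zmod_morphism f0.
  apply: zmod_morphismD => y z.
  rewrite /f0 /= qD raddfB raddfD [in LHS](addrC _ (p (l _ _))) addrA subrK.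
  exact: addrACA.
pose f1 : {additive extension l -> N} := HB.pack_for
  {additive extension l -> N} f0 (GRing.isZmodMorphism.Build _ _ f0 f0B).
have f1R y : univ_rel y -> f1 y = 0.
  case=> a; rewrite /f1 /= /f0 /= -[- (a *+ 2)]mulNrn [- a *+ 2]mulr2n qD -mulr2n q2.
  by rewrite sformNl sformNr opprK !raddfN raddfMn /= -mulr2n addNr.
pose f2 : univ_e l -> N := zlift f1.
exists (HB.pack_for {additive univ_e l -> N} f2
  (GRing.isZmodMorphism.Build _ _ f2 (zlift_is_zmod_morphism f1R))).
have q0 : q 0 = 0.
  by apply: (addrI (q 0)); have := qD 0 0; rewrite addr0 sform0l raddf0 !addr0.
split=> [x|a]; rewrite /= /f2 /univ_p /univ_mu (zliftE f1R) /= /f0 /=.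
  by rewrite q0 addr0.
by rewrite raddf0 add0r.
Qed.

End Universal.

(** * Twisted trees *)

Section Trees.
Context (m n : nat).
Local Notation A := (quasiLie m n).
Local Notation M := (treeG m (2 * n)).
Local Notation T := (treeG_inf m n).
Local Notation lam := (glue_form m n).

Definition inf_p (x : M) : T := zpi (@twisted_rel m n) (x, 0).

Lemma inf_p_is_zmod_morphism : zmod_morphism inf_p.
Proof.
by move=> x y; rewrite /inf_p -raddfB; congr zpi; congr (_, _); rewrite /= subr0.
Qed.

HB.instance Definition _ :=
  GRing.isZmodMorphism.Build M T inf_p inf_p_is_zmod_morphism.

Definition inf_free (y : free_ab (rtree_of m n)) : T :=
  zpi (@twisted_rel m n) (0, y).

Lemma inf_free_is_zmod_morphism : zmod_morphism inf_free.
Proof.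
by move=> x y; rewrite /inf_free -raddfB; congr zpi; congr (_, _); rewrite /= subr0.
Qed.

HB.instance Definition _ :=
  GRing.isZmodMorphism.Build (free_ab (rtree_of m n)) T inf_free
    inf_free_is_zmod_morphism.

Lemma inf_decomp (x : M) (y : free_ab (rtree_of m n)) :
  zpi (@twisted_rel m n) (x, y) = inf_p x + inf_free y.
Proof.
by rewrite /inf_p /inf_free -raddfD; congr zpi; congr (_, _); rewrite /= ?addr0 ?add0r.
Qed.

Lemma inf_rel (x : M) (y : free_ab (rtree_of m n)) :
  twisted_rel (x, y) -> inf_p x + inf_free y = 0.
Proof. by move=> r; rewrite -inf_decomp; apply: zpi_rel. Qed.

Lemma inf_ext (N : zmodType) (f g : {additive T -> N}) :
  (forall t, f (inf_utr t) = g (inf_utr t)) ->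
  (forall J, f (inf_rtr J) = g (inf_rtr J)) -> f =1 g.
Proof.
move=> fgt fgJ x; rewrite -[x]zpi_repr; case: (zrepr x) => t y.
rewrite inf_decomp !raddfD; congr (_ + _).
  apply: (zpi_ext (f := f \o inf_p) (g := g \o inf_p)) => [||k]; try exact: raddfB.
  exact: fgt.
by apply: (fgen_ext (f := f \o inf_free) (g := g \o inf_free)).
Qed.

Lemma inf_rtr_same (I J : rtree_of m n) :
  same_rtree I J -> inf_rtr I = inf_rtr J.
Proof.
move=> /twisted_rel_same/inf_rel; rewrite raddf0 add0r raddfB.
by move/eqP; rewrite subr_eq0 => /eqP.
Qed.

Lemma inf_rtr_AS (I J : rtree_of m n) :
  AS_rtree I J -> inf_rtr I = inf_rtr J.
Proof.
move=> /twisted_rel_sym/inf_rel; rewrite raddf0 add0r raddfB.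
by move/eqP; rewrite subr_eq0 => /eqP.
Qed.

Lemma inf_rtr2 (J : rtree_of m n) : inf_rtr J *+ 2 = inf_p (glue_tr J J).
Proof.
have /inf_rel := twisted_rel_double J.
rewrite raddfMn raddfN addrC => /eqP.
by rewrite subr_eq0 => /eqP.
Qed.

Lemma inf_rtr_IHX (I H X : rtree_of m n) : IHX_rtree I H X ->
  inf_rtr I = inf_rtr H + inf_rtr X - inf_p (glue_tr H X).
Proof.
move=> /twisted_rel_IHX/inf_rel; rewrite !raddfB addrC => /eqP.
by rewrite addr_eq0 -addrA -opprD subr_eq addrC => /eqP.
Qed.

Lemma rtr_same (I J : rtree_of m n) : same_rtree I J -> rtr I = rtr J.
Proof.
move=> /quasiLie_rel_same/zpi_rel; rewrite raddfB => /eqP.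
by rewrite subr_eq0 => /eqP.
Qed.

Lemma rtr_AS (I J : rtree_of m n) : AS_rtree I J -> rtr J = - rtr I.
Proof.
move=> /quasiLie_rel_AS/zpi_rel; rewrite raddfD addrC => /eqP.
by rewrite addr_eq0 => /eqP.
Qed.

Lemma rtr_IHX (I H X : rtree_of m n) :
  IHX_rtree I H X -> rtr I = rtr H - rtr X.
Proof.
move=> /quasiLie_rel_IHX/zpi_rel; rewrite raddfD raddfB => /eqP.
by rewrite -addrA addr_eq0 opprD opprK => /eqP.
Qed.

Lemma flift_quasiLie_rel (V : zmodType) (f : rtree_of m n -> V) :
  (forall I J : rtree_of m n, same_rtree I J -> f I = f J) ->
  (forall I J : rtree_of m n, AS_rtree I J -> f I + f J = 0) ->
  (forall I H X : rtree_of m n, IHX_rtree I H X -> f I + f X = f H) ->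
  forall r, quasiLie_rel r -> flift f r = 0.
Proof.
move=> f_same f_AS f_IHX r.
case=> [I J /f_same IJ|I J /f_AS IJ|I H X /f_IHX IHX].
- by rewrite raddfB /= !flift_gen IJ subrr.
- by rewrite raddfD /= !flift_gen.
- by rewrite raddfD raddfB /= !flift_gen addrAC IHX subrr.
Qed.

(** In the extension, AS becomes [- 2 J^oo + <J, J> = 0].  For IHX, the
    cocycle of [I + X] is [<H - X, X> = <H, X> - 2 X^oo], which cancels against
    the correction term of the twisted IHX relation. *)
Lemma inf_quad_exists :
  exists2 q : A -> T, refines (fun a b => inf_p (lam a b)) q
    & forall J, q (rtr J) = inf_rtr J.
Proof.
apply: (refines_exists (l := push_form lam inf_p)); apply: flift_quasiLie_rel.
- by move=> I J IJ; rewrite /quad_graph (inf_rtr_same IJ) -!/(rtr _) (rtr_same IJ).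
- move=> I J IJ; rewrite /quad_graph -!/(rtr _) (rtr_AS IJ) ext_addE push_formE.
  rewrite -(inf_rtr_AS IJ) subrr sformNr raddfN glue_formE /= -(inf_rtr2 I).
  by rewrite opprK -opprD -mulr2n addNr.
- move=> I H X IHX; rewrite /quad_graph -!/(rtr _) (rtr_IHX IHX) ext_addE.
  rewrite push_formE subrK; congr (_, _).
  rewrite sformDl sformNl !glue_formE raddfB /= -(inf_rtr2 X) (inf_rtr_IHX IHX).
  have E (h x g : T) : - (h + x - g) - x - (g - x *+ 2) = - h.
    rewrite !opprB -(addrA g) -opprD -(addrA h) -mulr2n.
    by rewrite [LHS]addrC addrA subrK opprD addrCA subrr addr0.
  exact: E.
Qed.

(** [mu] is even, which gives the AS relation without sign, and
    [mu(H - X) = mu H + mu X - <H, X>], which is the twisted IHX relation. *)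
Lemma tree_inf_to_univ : exists f : {additive T -> univ_e lam},
  (forall x, f (inf_p x) = univ_p lam x)
  /\ (forall J, f (inf_rtr J) = univ_mu lam (rtr J)).
Proof.
pose mu := univ_mu lam.
pose f0 (y : M * free_ab (rtree_of m n)) : univ_e lam :=
  univ_p lam y.1 + flift (fun J => mu (rtr J)) y.2.
have f0B : zmod_morphism f0.
  by move=> y z; rewrite /f0 !raddfB /= opprD addrACA.
pose f1 : {additive M * free_ab (rtree_of m n) -> univ_e lam} := HB.pack_for
  {additive M * free_ab (rtree_of m n) -> univ_e lam} f0
  (GRing.isZmodMorphism.Build _ _ f0 f0B).
have f1R y : twisted_rel y -> f1 y = 0.
  case=> [I J IJ|I J IJ|J|I H X IHX]; rewrite /f1 /= /f0 /=.
  - by rewrite raddfB /= !flift_gen raddf0 (rtr_same IJ) subrr addr0.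
  - by rewrite raddfB /= !flift_gen raddf0 (rtr_AS IJ) /mu univ_muN subrr addr0.
  - by rewrite raddfMn raddfN /= flift_gen /mu univ_mu2 glue_formE addNr.
  - rewrite !raddfB /= !flift_gen (rtr_IHX IHX) /mu univ_muD univ_muN.
    rewrite sformNr raddfN glue_formE.
    rewrite addrC (addrAC _ (- univ_p _ _)) (addrAC _ (- univ_p _ _)) subrK.
    by rewrite -addrA -opprD subrr.
pose f2 : T -> univ_e lam := zlift f1.
exists (HB.pack_for {additive T -> univ_e lam} f2
  (GRing.isZmodMorphism.Build _ _ f2 (zlift_is_zmod_morphism f1R))).
split=> [x|J]; rewrite /= /f2 /inf_p /inf_rtr (zliftE f1R) /= /f0 /=.
  by rewrite raddf0 addr0.
by rewrite raddf0 add0r flift_gen.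
Qed.

End Trees.

Theorem corollary44 (m n : nat) (hm : (1 <= m)%N) :
  exists (p : {additive treeG m (2 * n) -> treeG_inf m n})
         (h : {additive treeG_inf m n -> treeG m (2 * n)})
         (hp : forall x, h (p x) = x *+ 2)
         (ph : forall y, p (h y) = y *+ 2),
    [/\ (forall t : utree_of m (2 * n), p (utr t) = inf_utr t)
        /\ (forall p' : {additive treeG m (2 * n) -> treeG_inf m n},
              (forall t, p' (utr t) = inf_utr t) -> p' =1 p),
        [/\ forall t : utree_of m (2 * n), h (inf_utr t) = utr t *+ 2,
            forall J : rtree_of m n, h (inf_rtr J) = utr (glue_of J J)
          & forall h' : {additive treeG_inf m n -> treeG m (2 * n)},
              (forall t, h' (inf_utr t) = utr t *+ 2) ->
              (forall J, h' (inf_rtr J) = utr (glue_of J J)) -> h' =1 h]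
      & exists F : sqhom (univ_group (glue_form m n)) (SQGroup hp ph),
          [/\ sqiso F,
              forall x : treeG m (2 * n), hom_ee F x = x
            & forall J : rtree_of m n,
                hom_e F (univ_mu (glue_form m n) (rtr J)) = inf_rtr J]].
Proof.
have [q qD qJ] := inf_quad_exists m n.
have q2 a : q a *+ 2 = inf_p (glue_form m n a a).
  apply: (refines_ext (b := fun a b => inf_p (glue_form m n a b) *+ 2)
    (q := fun a => q a *+ 2) (q' := fun a => inf_p (glue_form m n a a))) a.
  - by move=> a b; rewrite qD !mulrnDl.
  - move=> a b; rewrite sformDl !sformDr (sformC _ b a) !raddfD mulr2n.
    by rewrite [RHS]addrACA (addrC (inf_p (glue_form m n b b))).
  - by move=> J; rewrite -/(rtr J) qJ inf_rtr2 glue_formE.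
have [psi [psi_p psi_q]] := univ_lift qD q2.
have [phi [phi_p phi_J]] := tree_inf_to_univ m n.
have phiK : cancel phi psi.
  apply: (inf_ext (f := psi \o phi) (g := idfun)) => [t|J] /=.
    by rewrite /= -/(inf_p (utr t)) phi_p psi_p.
  by rewrite phi_J psi_q qJ.
have phi_q a : phi (q a) = univ_mu (glue_form m n) a.
  apply: (refines_ext (b := fun a b => univ_p _ (glue_form m n a b))
    (q := fun a => phi (q a)) (q' := univ_mu _)) a.
  - by move=> a b; rewrite qD !raddfD phi_p.
  - exact: univ_muD.
  - by move=> J; rewrite -/(rtr J) qJ phi_J.
have psiK : cancel psi phi.
  move=> y; rewrite -[y]zpi_repr; case: (zrepr y) => x a.
  by rewrite univ_decomp !raddfD psi_p phi_p psi_q phi_q.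
pose p : {additive treeG m (2 * n) -> treeG_inf m n} := @inf_p m n.
pose h : {additive treeG_inf m n -> treeG m (2 * n)} :=
  univ_h (l := glue_form m n) \o phi.
have hp x : h (p x) = x *+ 2 by rewrite /h /= phi_p univ_hp.
have ph y : p (h y) = y *+ 2.
  (* [phi] is injective, so the identity can be checked in the universal group. *)
  by apply: (can_inj phiK); rewrite /p /h /= phi_p univ_ph raddfMn.
have ht (t : utree_of m (2 * n)) : h (inf_utr t) = utr t *+ 2 := hp (utr t).
have hJ J : h (inf_rtr J) = utr (glue_of J J).
  by rewrite /h /= phi_J univ_h_mu glue_formE.
exists p, h, hp, ph; split.
- split=> // p' p't; apply: zpi_ext; try exact: raddfB.
  by move=> t; rewrite -/(utr t) p't.
- split=> // h' h't h'J; apply: inf_ext => [t|J].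
    by rewrite h't ht.
  by rewrite h'J hJ.
have psi_h x : idfun (sq_h (univ_group (glue_form m n)) x)
    = sq_h (SQGroup hp ph) (psi x) by rewrite /= psiK.
exists (@SQHom (univ_group (glue_form m n)) (SQGroup hp ph) psi idfun psi_h psi_p).
split=> //; last by move=> J /=; rewrite psi_q qJ.
by split; [exists phi | exists id].
Qed.
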